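(* Let $\mathbb{F}$ be a field, let $n,m$ be positive integers, and let $(i_1,j_1),\dots,(i_s,j_s)$ be pairwise distinct positions in $\{1,\dots,n\}\times\{1,\dots,m\}$. Let $A=(a_{i,j})$ be an $n\times m$ matrix over $\mathbb{F}$ with $a_{i_k,j_k}=0$ for $k=1,\dots,s$, identified with the tensor $A=\sum_{i=1}^n\sum_{j=1}^m a_{i,j}(e_i\otimes e_j)\in\mathbb{F}^n\otimes\mathbb{F}^m$. Put $u_k=e_{i_k}\in\mathbb{F}^n$ and $v_k=e_{j_k}\in\mathbb{F}^m$ for $k=1,\dots,s$, let $U\subseteq \mathbb{F}^n\otimes\mathbb{F}^m$ be the subspace spanned by $u_1\otimes v_1,\dots,u_s\otimes v_s$, and define $$\operatorname{rank}(A,U)=\min\{\operatorname{rank}(B)\mid B\in A+U\}.$$ Define the third order tensor $\widehat{A}\in\mathbb{F}^n\otimes\mathbb{F}^m\otimes\mathbb{F}^{s+1}$ by $$\widehat{A}=A\otimes e_{s+1}+\sum_{k=1}^s u_k\otimes v_k\otimes e_k.$$ Then $$\operatorname{rank}(A,U)+s=\operatorname{rank}(\widehat{A}).$$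
   Context: In each space $\mathbb{F}^N$, $e_i$ denotes the $i$-th standard basis vector. For finite dimensional $\mathbb{F}$-vector spaces $V^{(1)},\dots,V^{(d)}$, a pure tensor in $V^{(1)}\otimes\cdots\otimes V^{(d)}$ is an element of the form $v^{(1)}\otimes\cdots\otimes v^{(d)}$ with $v^{(i)}\in V^{(i)}$ for all $i$. The rank $\operatorname{rank}(T)$ of a tensor $T\in V^{(1)}\otimes\cdots\otimes V^{(d)}$ is the smallest nonnegative integer $r$ such that $T$ can be written as a sum of $r$ pure tensors. For $d=2$, under the identification of an $n\times m$ matrix $(b_{i,j})$ with $\sum_{i,j} b_{i,j}(e_i\otimes e_j)\in\mathbb{F}^n\otimes\mathbb{F}^m$, this coincides with the usual matrix rank. The positions $(i_k,j_k)$ are the undetermined entries of a partially filled $n\times m$ array, set to $0$ in $A$; the set $A+U$ consists of all completions of the array. *)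

(* Defs.v *)
From mathcomp Require Import all_boot all_order all_algebra.
From mathcomp Require Import boolp.

Set Implicit Arguments.
Unset Strict Implicit.
Unset Printing Implicit Defensive.

Import GRing.Theory.
Local Open Scope ring_scope.

(* Coordinate model: F^N is tensor F 'I_N, and F^I ⊗ F^J is F^(I * J); so     *)
(* F^n ⊗ F^m is tensor F ('I_n * 'I_m) and F^n ⊗ F^m ⊗ F^p is                 *)
(* tensor F ('I_n * 'I_m * 'I_p).  The codomain is F^o, not F, because the    *)
(* library gives {ffun I -> V} its vectType structure for V a vectType.       *)
Notation tensor F I := {ffun I -> F^o}.

Definition tens (F : fieldType) (I J : finType)
    (u : tensor F I) (v : tensor F J) : tensor F (I * J)%type :=
  [ffun x : I * J => (u x.1 : F) * (v x.2 : F)].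

Notation "u ⊗ v" := (tens u v) (at level 40, left associativity) : ring_scope.

Definition basis_vec (F : fieldType) (N : nat) (i : 'I_N) : tensor F 'I_N :=
  [ffun j => (j == i)%:R].
Arguments basis_vec F {N} i.

Definition pure2 (F : fieldType) (n m : nat)
    (T : tensor F ('I_n * 'I_m)%type) : Prop :=
  exists (u : tensor F 'I_n) (v : tensor F 'I_m), T = u ⊗ v.

Definition pure3 (F : fieldType) (n m p : nat)
    (T : tensor F ('I_n * 'I_m * 'I_p)%type) : Prop :=
  exists (u : tensor F 'I_n) (v : tensor F 'I_m) (w : tensor F 'I_p),
    T = u ⊗ v ⊗ w.

Definition is_sum_of (V : zmodType) (P : V -> Prop) (T : V) (r : nat) : Prop :=
  exists p : 'I_r -> V, (forall k, P (p k)) /\ T = \sum_(k < r) p k.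

Lemma is_sum_of_fin (V : zmodType) (P : V -> Prop) (K : finType) (p : K -> V) :
  (forall k, P (p k)) -> is_sum_of P (\sum_k p k) #|K|.
Proof.
move=> Pp; exists (fun k => p (enum_val k)); split=> // .
exact: big_enum_val.
Qed.

Lemma tensor_sum (F : fieldType) (I : finType) (T : tensor F I) :
  T = \sum_i [ffun j => T i * (j == i)%:R].
Proof.
apply/ffunP=> j; rewrite sum_ffunE (bigD1 j) //= !ffunE eqxx mulr1 big1 ?addr0 //.
by move=> i /negbTE ij; rewrite ffunE eq_sym ij mulr0.
Qed.

Lemma rank2_ex (F : fieldType) (n m : nat) (T : tensor F ('I_n * 'I_m)%type) :
  exists r, `[< is_sum_of (@pure2 F n m) T r >].
Proof.
exists #|{: 'I_n * 'I_m}|; apply/asboolP; rewrite {1}[T]tensor_sum.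
apply: is_sum_of_fin => -[i j].
exists (T (i, j) *: basis_vec F i), (basis_vec F j).
apply/ffunP=> -[i' j']; rewrite !ffunE /= /GRing.scale /= -mulrA -natrM mulnb.
by rewrite xpair_eqE.
Qed.

Lemma rank3_ex (F : fieldType) (n m p : nat)
    (T : tensor F ('I_n * 'I_m * 'I_p)%type) :
  exists r, `[< is_sum_of (@pure3 F n m p) T r >].
Proof.
exists #|{: 'I_n * 'I_m * 'I_p}|; apply/asboolP; rewrite {1}[T]tensor_sum.
apply: is_sum_of_fin => -[[i j] k].
exists (T (i, j, k) *: basis_vec F i), (basis_vec F j), (basis_vec F k).
apply/ffunP=> -[[i' j'] k']; rewrite !ffunE /= /GRing.scale /= -!mulrA -!natrM.
by rewrite !mulnb !xpair_eqE andbA.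
Qed.

Definition rank2 (F : fieldType) (n m : nat)
    (T : tensor F ('I_n * 'I_m)%type) : nat := ex_minn (rank2_ex T).

Definition rank3 (F : fieldType) (n m p : nat)
    (T : tensor F ('I_n * 'I_m * 'I_p)%type) : nat := ex_minn (rank3_ex T).

Definition mx_tensor (F : fieldType) (n m : nat) (A : 'M[F]_(n, m)) :
    tensor F ('I_n * 'I_m)%type :=
  \sum_(i < n) \sum_(j < m) A i j *: (basis_vec F i ⊗ basis_vec F j).

Lemma rank_coset_ex (F : fieldType) (n m : nat)
    (T : tensor F ('I_n * 'I_m)%type)
    (U : {vspace tensor F ('I_n * 'I_m)%type}) :
  exists r, `[< exists B, B - T \in U /\ rank2 B = r >].
Proof. by exists (rank2 T); apply/asboolP; exists T; rewrite subrr mem0v. Qed.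

Definition rank_coset (F : fieldType) (n m : nat)
    (T : tensor F ('I_n * 'I_m)%type)
    (U : {vspace tensor F ('I_n * 'I_m)%type}) : nat :=
  ex_minn (rank_coset_ex T U).

Definition span_tens (F : fieldType) (n m s : nat)
    (u : 'I_s -> tensor F 'I_n) (v : 'I_s -> tensor F 'I_m) :
    {vspace tensor F ('I_n * 'I_m)%type} :=
  <<[seq u k ⊗ v k | k : 'I_s]>>%VS.

(* The last basis vector e_(s+1) is indexed by ord_max, and e_1, .., e_s by   *)
(* the image of 'I_s under widen_ord.                                         *)
Definition hat (F : fieldType) (n m s : nat)
    (T : tensor F ('I_n * 'I_m)%type)
    (u : 'I_s -> tensor F 'I_n) (v : 'I_s -> tensor F 'I_m) :
    tensor F ('I_n * 'I_m * 'I_s.+1)%type :=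
  T ⊗ basis_vec F (@ord_max s) +
  \sum_(k < s) u k ⊗ v k ⊗ basis_vec F (widen_ord (leqnSn s) k).

(* Main.v *)
Require Import Defs.
From mathcomp Require Import all_boot all_order all_algebra.
From mathcomp Require Import boolp.

Set Implicit Arguments.
Unset Strict Implicit.
Unset Printing Implicit Defensive.

Import GRing.Theory.
Local Open Scope ring_scope.

(** The identity holds for every tensor [T] and all families [u], [v] for which
    the pure tensors [u k ⊗ v k] are linearly independent; for matrix entries
    at distinct positions these tensors are distinct standard basis vectors.

    Upper bound ([rank3_hat_le]).  If [B = T + \sum_k c k *: u k ⊗ v k], the
    completion [B] can be traded for [T] at no cost by changing the third
    factors:  [hat T u v = B ⊗ e + \sum_k u k ⊗ v k ⊗ (e_k - c k *: e)], with
    [e] the last basis vector.  This uses [rank2 B + s] pure tensors.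

    Lower bound ([rank_coset_le_hat]).  Write [hat T u v] as a sum of [r] tensors
    [a l ⊗ b l ⊗ w l].  The slices in the third direction (counted from 0) give
    [u k ⊗ v k = \sum_l w l k *: a l ⊗ b l] and
    [T = \sum_l w l s *: a l ⊗ b l].  Independence of the [u k ⊗ v k] makes the
    [s] coefficient rows [(w l k)_l] independent, so they contain an invertible
    [s * s] minor, and a combination of them cancels the last row
    [(w l s)_l] on the [s] columns of this minor
    ([row_free_cancel]).  Subtracting the same combination of the
    [u k ⊗ v k] from [T] gives an element of [T + U] that needs only
    the remaining [r - s] pure tensors. *)

(** * Sums of pure tensors and ranks *)

Section SumsOfPure.

Variables (V : zmodType) (P : V -> Prop).

Lemma is_sum_of_sub (K : finType) (D : {pred K}) (p : K -> V) :
  (forall k, P (p k)) -> is_sum_of P (\sum_(k in D) p k) #|D|.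
Proof.
move=> Pp; exists (fun k => p (enum_val k)); split=> //.
exact: big_enum_val.
Qed.

Lemma is_sum_of_add x y r t :
  is_sum_of P x r -> is_sum_of P y t -> is_sum_of P (x + y) (r + t).
Proof.
case=> p [Pp ->] [q [Pq ->]].
exists (fun k => match split k with inl i => p i | inr j => q j end); split.
  by move=> k; case: (split k).
rewrite big_split_ord /=; congr (_ + _); apply: eq_bigr => i _.
  by rewrite (unsplitK (inl i)).
by rewrite (unsplitK (inr i)).
Qed.

Lemma is_sum_of_map (W : zmodType) (Q : W -> Prop) (f : V -> W) x r :
    {morph f : a b / a + b} -> f 0 = 0 -> (forall a, P a -> Q (f a)) ->
  is_sum_of P x r -> is_sum_of Q (f x) r.
Proof.
move=> fD f0 PQ [p [Pp ->]]; exists (f \o p); split=> [k|]; first exact: PQ.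
exact: big_morph.
Qed.

End SumsOfPure.

Section Ranks.

Variables (F : fieldType) (n m p : nat).
Implicit Types (T B : tensor F ('I_n * 'I_m)%type).
Implicit Types (H : tensor F ('I_n * 'I_m * 'I_p)%type).

Lemma rank2_min T r : is_sum_of (@pure2 F n m) T r -> (rank2 T <= r)%N.
Proof. by move=> Tr; rewrite /rank2; case: ex_minnP => q _; apply; apply/asboolP. Qed.

Lemma rank2_sum T : is_sum_of (@pure2 F n m) T (rank2 T).
Proof. by rewrite /rank2; case: ex_minnP => q /asboolP. Qed.

Lemma rank3_min H r : is_sum_of (@pure3 F n m p) H r -> (rank3 H <= r)%N.
Proof. by move=> Hr; rewrite /rank3; case: ex_minnP => q _; apply; apply/asboolP. Qed.

Lemma rank3_sum H : is_sum_of (@pure3 F n m p) H (rank3 H).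
Proof. by rewrite /rank3; case: ex_minnP => q /asboolP. Qed.

Lemma rank_coset_min T (U : {vspace _}) B :
  B - T \in U -> (rank_coset T U <= rank2 B)%N.
Proof.
move=> BU; rewrite /rank_coset; case: ex_minnP => q _; apply.
by apply/asboolP; exists B.
Qed.

Lemma rank_coset_witness T (U : {vspace _}) :
  exists2 B, B - T \in U & rank2 B = rank_coset T U.
Proof.
by rewrite /rank_coset; case: ex_minnP => q /asboolP[B [BU rB]] _; exists B.
Qed.

Lemma pure2_scale (c : F) T : pure2 T -> pure2 (c *: T).
Proof.
case=> a [b ->]; exists (c *: a), b.
by apply/ffunP => x; rewrite !ffunE /GRing.scale /= mulrA.
Qed.

End Ranks.

Lemma tensDl (F : fieldType) (I J : finType) (w : tensor F J) :
  {morph (fun T : tensor F I => T ⊗ w) : T T' / T + T'}.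
Proof. by move=> T T'; apply/ffunP => x; rewrite !ffunE mulrDl. Qed.

Lemma tens0l (F : fieldType) (I J : finType) (w : tensor F J) :
  (0 : tensor F I) ⊗ w = 0.
Proof. by apply/ffunP => x; rewrite !ffunE mul0r. Qed.

(** * Cancelling a row on as many columns as there are independent rows *)

(** The columns in the image of [f] form an invertible minor of [C], so the
    system for [x] restricted to them is solvable. *)
Lemma row_free_cancel (F : fieldType) (s r : nat) (C : 'M[F]_(s, r))
    (d : 'rV[F]_r) : row_free C ->
  exists x : 'rV[F]_s, exists2 f : 'I_s -> 'I_r,
    injective f & forall k, (d - x *m C) 0 (f k) = 0.
Proof.
move=> freeC; have fullCt : row_full C^T.
  by rewrite /row_full mxrank_tr -/(row_free C).
set f := fullrankfun fullCt.
have unitCf : colsub f C \in unitmx.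
  by rewrite -unitmx_tr trmx_mxsub fullrowsub_unit.
exists (colsub f d *m invmx (colsub f C)), f; first exact: fullrankfun_inj.
set x := _ *m invmx _ => k.
have : colsub f (d - x *m C) = 0.
  by rewrite linearB /= -mulmx_colsub /x mulmxKV ?subrr.
by move/matrixP/(_ 0 k); rewrite !mxE.
Qed.

(** * The two inequalities *)

Section Hat.

Variables (F : fieldType) (n m s : nat).
Variables (T : tensor F ('I_n * 'I_m)%type).
Variables (u : 'I_s -> tensor F 'I_n) (v : 'I_s -> tensor F 'I_m).

Lemma span_tensP X :
  reflect (exists c : 'I_s -> F, X = \sum_k c k *: (u k ⊗ v k))
          (X \in span_tens u v).
Proof.
rewrite /span_tens span_def big_image /=.
apply: (iffP memv_sumP) => [[y yU ->] | [c ->]].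
  have /fin_all_exists[c yE] k : exists c, y k = c *: (u k ⊗ v k).
    by have /vlineP := yU k isT.
  by exists c; apply: eq_bigr => k _; rewrite yE.
by exists (fun k => c k *: (u k ⊗ v k)) => // k _; apply: memvZ; apply: memv_line.
Qed.

Lemma hat_slice_last x : hat T u v (x, ord_max) = T x.
Proof.
rewrite /hat ffunE sum_ffunE !ffunE /= eqxx mulr1 big1 ?addr0 // => k _.
by rewrite !ffunE -val_eqE /= gtn_eqF ?mulr0.
Qed.

Lemma hat_slice x k : hat T u v (x, widen_ord (leqnSn s) k) = (u k ⊗ v k) x.
Proof.
rewrite /hat ffunE sum_ffunE !ffunE /= -val_eqE /= ltn_eqF // mulr0 add0r.
rewrite (bigD1 k) //= big1 ?addr0 => [|l lk]; rewrite !ffunE /= -val_eqE /=.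
  by rewrite eqxx mulr1.
by rewrite val_eqE eq_sym (negbTE lk) mulr0.
Qed.

(** Moving [\sum_k c k *: (u k ⊗ v k)] into the first factor of the last slice
    is compensated term by term in the third factors. *)
Lemma hat_completion (c : 'I_s -> F) :
  hat T u v = (T + \sum_k c k *: (u k ⊗ v k)) ⊗ basis_vec F ord_max
    + \sum_k u k ⊗ v k
        ⊗ (basis_vec F (widen_ord (leqnSn s) k) - c k *: basis_vec F ord_max).
Proof.
apply/ffunP => x; rewrite /hat !(ffunE, sum_ffunE) mulrDl -addrA; congr (_ + _).
rewrite mulr_suml -big_split /=; apply: eq_bigr => k _.
by rewrite !ffunE /GRing.scale /= mulrBr addrC mulrCA -!mulrA addrNK.
Qed.

Lemma rank3_hat_le :
  (rank3 (hat T u v) <= rank_coset T (span_tens u v) + s)%N.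
Proof.
have [B /span_tensP[c BE] <-] := rank_coset_witness T (span_tens u v).
apply: rank3_min; rewrite (hat_completion c) -BE [T + _]addrC subrK.
apply: is_sum_of_add.
  have addE := tensDl (I := ('I_n * 'I_m)%type) (basis_vec F (@ord_max s)).
  apply: (is_sum_of_map addE (tens0l _ _) _ (rank2_sum B)).
  by move=> _ [a [b ->]]; exists a, b, (basis_vec F ord_max).
eexists; split; last by reflexivity.
by move=> k; do 3!eexists.
Qed.

(** Independence of the [u k ⊗ v k] gives independent coefficient rows, whence
    [s] of the terms in any decomposition of [hat T u v] can be eliminated from
    its last slice by moving within the coset of [T]. *)
Lemma rank_coset_le_hat :
    (forall c : 'I_s -> F,
       \sum_k c k *: (u k ⊗ v k) = 0 -> forall k, c k = 0) ->
  (rank_coset T (span_tens u v) + s <= rank3 (hat T u v))%N.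
Proof.
move=> uv_free; have := rank3_sum (hat T u v).
move: (rank3 _) => r [p [/fin_all_exists[a] /fin_all_exists[b]]].
move=> /fin_all_exists[w pE] hatE.
have sliceE x k : hat T u v (x, k) = (\sum_l w l k *: (a l ⊗ b l)) x.
  rewrite hatE !sum_ffunE; apply: eq_bigr => l _.
  by rewrite pE !ffunE /GRing.scale /= mulrC.
have TE : T = \sum_l w l ord_max *: (a l ⊗ b l).
  by apply/ffunP => x; rewrite -sliceE hat_slice_last.
pose C := \matrix_(k < s, l < r) (w l (widen_ord (leqnSn s) k) : F).
have uvE k : u k ⊗ v k = \sum_l C k l *: (a l ⊗ b l).
  apply/ffunP => x; rewrite -hat_slice sliceE; congr (fun_of_fin _ x).
  by apply: eq_bigr => l _; rewrite mxE.
have combE (x : 'rV[F]_s) :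
    \sum_k x 0 k *: (u k ⊗ v k) = \sum_l (x *m C) 0 l *: (a l ⊗ b l).
  under eq_bigr do rewrite uvE scaler_sumr.
  rewrite exchange_big /=; apply: eq_bigr => l _.
  by rewrite mxE scaler_suml; apply: eq_bigr => k _; rewrite scalerA.
have freeC : row_free C.
  apply: inj_row_free => x xC.
  apply/rowP => k; rewrite [RHS]mxE; apply: uv_free k.
  by rewrite combE xC big1 // => l _; rewrite mxE scale0r.
pose d := \row_l (w l ord_max : F).
have [x [f f_inj xf0]] := row_free_cancel d freeC.
pose B := T - \sum_k x 0 k *: (u k ⊗ v k).
(* The cancelled columns are the terms indexed by the image of f. *)
have BE : B = \sum_(l in [predC codom f]) (d - x *m C) 0 l *: (a l ⊗ b l).
  rewrite /B combE TE -sumrB [RHS]big_mkcond /=; apply: eq_bigr => l _.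
  rewrite -scalerBl inE; case: ifPn => [_|/negPn/codomP[k ->]].
    by rewrite !mxE.
  by have := xf0 k; rewrite !mxE => ->; rewrite scale0r.
have BU : B - T \in span_tens u v.
  apply/span_tensP; exists (fun k => - x 0 k).
  rewrite /B addrAC subrr add0r -sumrN.
  by apply: eq_bigr => k _; rewrite scaleNr.
have rankB : (rank2 B <= #|[predC codom f]|)%N.
  apply: rank2_min; rewrite BE; apply: is_sum_of_sub => l.
  by apply: pure2_scale; exists (a l), (b l).
have <- : (#|codom f| + #|[predC codom f]| = r)%N by rewrite cardC card_ord.
rewrite card_codom // card_ord addnC leq_add2l.
exact: leq_trans (rank_coset_min BU) rankB.
Qed.

End Hat.

Theorem theorem2 (F : fieldType) (n m s : nat) (n_gt0 : (0 < n)%N)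
    (m_gt0 : (0 < m)%N) (i_ : 'I_s -> 'I_n) (j_ : 'I_s -> 'I_m)
    (pos_inj : injective (fun k => (i_ k, j_ k)))
    (A : 'M[F]_(n, m)) (A0 : forall k, A (i_ k) (j_ k) = 0) :
  let u k := basis_vec F (i_ k) in
  let v k := basis_vec F (j_ k) in
  let U := span_tens u v in
  (rank_coset (mx_tensor A) U + s)%N = rank3 (hat (mx_tensor A) u v).
Proof.
move=> u v U; apply/eqP; rewrite eqn_leq rank3_hat_le andbT.
apply: rank_coset_le_hat => c c0 k.
(* Only the k-th summand is nonzero at position (i_ k, j_ k). *)
have := congr1 (fun X : tensor F _ => X (i_ k, j_ k)) c0.
rewrite sum_ffunE (bigD1 k) //= !ffunE /= !eqxx /GRing.scale /= !mulr1.
rewrite big1 ?addr0 // => l lk; rewrite !ffunE /= -natrM mulnb -xpair_eqE.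
by rewrite (inj_eq pos_inj k l) eq_sym (negbTE lk); apply: mulr0.
Qed.
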